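(* There exists an absolute constant $C>0$ such that, if $L$ is an order-$n$ Latin square chosen uniformly at random, then $\Pr\left(\varepsilon(L) \le C n^2 \log^2 n\right) \to 1$ as $n\to\infty$. That is, asymptotically almost every order-$n$ Latin square $L$ satisfies $\varepsilon(L) = O(n^2\log^2 n)$.
   Context: Write $[n]=\{1,\dots,n\}$. An order-$n$ Latin square is a map $L:[n]\times[n]\to[n]$ such that for each fixed $i$ the map $j\mapsto L(i,j)$ is a bijection and for each fixed $j$ the map $i\mapsto L(i,j)$ is a bijection. For $X,Y,Z\subseteq[n]$, the box $X\times Y\times Z$ is called an empty box of $L$ if there are no $i\in X$, $j\in Y$ with $L(i,j)\in Z$; its volume is $|X||Y||Z|$. $\varepsilon(L)$ denotes the maximum volume of an empty box of $L$. *)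

(* Defs.v *)
From mathcomp Require Import all_boot all_order all_algebra.
From mathcomp Require Import all_classical all_reals all_analysis.

Set Implicit Arguments.
Unset Strict Implicit.
Unset Printing Implicit Defensive.

Import Order.TTheory GRing.Theory Num.Theory.

Local Open Scope ring_scope.

(* Rows, columns and symbols are indexed by 'I_n = {0, ..., n-1}. *)
Definition array (n : nat) := {ffun 'I_n * 'I_n -> 'I_n}.

Definition latin (n : nat) (L : array n) : Prop :=
  (forall i : 'I_n, bijective (fun j : 'I_n => L (i, j))) /\
  (forall j : 'I_n, bijective (fun i : 'I_n => L (i, j))).

Definition latin_squares (n : nat) : {set array n} :=
  [set L : array n | `[< latin L >]]%SET.

Definition empty_box (n : nat) (L : array n) (X Y Z : {set 'I_n}) : bool :=
  ~~ [exists i in X, exists j in Y, L (i, j) \in Z].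

Definition box_volume (n : nat) (X Y Z : {set 'I_n}) : nat :=
  (#|X| * #|Y| * #|Z|)%N.

Definition max_empty_box (n : nat) (L : array n) : nat :=
  (\max_(B : {set 'I_n} * {set 'I_n} * {set 'I_n}
           | empty_box L B.1.1 B.1.2 B.2)
      box_volume B.1.1 B.1.2 B.2)%N.

(* Probability that E holds for an element drawn uniformly from A; this is 0
   when A is empty. *)
Definition uniform_draw_prob (R : realType) (T : finType) (A : {set T})
    (E : pred T) : R :=
  #|[set x in A | E x]%SET|%:R / #|A|%:R.

(* Main.v *)
Require Import Defs.
From mathcomp Require Import all_boot all_order all_algebra all_fingroup all_field.
From mathcomp Require Import all_classical all_reals all_analysis.
From mathcomp Require Import ring lra zify.

Set Implicit Arguments.
Unset Strict Implicit.
Unset Printing Implicit Defensive.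

Import Order.TTheory GRing.Theory Num.Theory.
Import numFieldNormedType.Exports.

Local Open Scope ring_scope.

(* Build Latin squares row by row.  Given m rows, the candidates for the next
   one are the permutations contained in an (n - m)-regular bipartite graph;
   Gurvits' capacity argument gives at least (n - m)^n n! / (n + 1)^n of them,
   hence at least (n!)^(2n) / (n + 1)^(n^2) Latin squares.  If X x Y x Z is an
   empty box, start with the rows in X: each of them only has n - m - |Z|
   admissible symbols in the columns of Y, and Bregman's theorem bounds the
   number of such Latin squares.  The two bounds differ by a factor
   exp(O(n log^2 n) - |X||Y||Z|/n), which beats the 2^(3n) choices of the box
   as soon as |X||Y||Z| > C n^2 log^2 n. *)

(** * A lower bound for permanents of regular matrices *)

(** The two counts may differ only by exp(O(n log^2 n)), so on average a row can afford an error of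
    exp(O(log^2 n)). From below, the product of the row sums of a d-regular 0/1 matrix has capacity
    at least d^n, and the permanent is its mixed derivative in all variables. Each differentiation
    costs a bounded factor because restrictions to positive lines have only negative real roots, a
    consequence of having no zeros in the right half-plane. The one-variable inequality used here
    yields n!/(n + 1)^n where the sharp van der Waerden constant is n!/n^n; the loss is below e per
    row, hence e^n in all, which is harmless. The log^2 n has two sources: the Stirling error (ln r
    + 1)/r at degree r gives one logarithm, and its harmonic sum over the degrees gives the
    other. *)

(* The permanent of A with its first k columns replaced by y.  Up to a factor
   k!, it is what remains of the product of the y_i after differentiating in
   the directions of the last n - k columns of A. *)
Definition mixed_per (K : comNzRingType) n (A : 'I_n -> 'I_n -> K) (k : nat)
    (y : 'I_n -> K) : K :=
  \sum_(s : 'S_n) \prod_i (if (s i < k)%N then y i else A i (s i)).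

Lemma eq_mixed_per (K : comNzRingType) n (A : 'I_n -> 'I_n -> K) k y z :
  y =1 z -> mixed_per A k y = mixed_per A k z.
Proof.
by move=> yz; apply: eq_bigr => s _; apply: eq_bigr => i _; rewrite yz.
Qed.

Lemma card_perm_lt n k (s : 'S_n) : (k <= n)%N -> (\sum_(i | (s i < k)%N) 1 = k)%N.
Proof.
move=> kn; rewrite (reindex_inj (@perm_inj _ (s^-1)%g)) /=.
under eq_bigl do rewrite permKV.
by rewrite (@big_ord_narrow _ _ _ _ _ _ kn) /= sum1_card card_ord.
Qed.

Lemma mixed_perZ (K : comNzRingType) n (A : 'I_n -> 'I_n -> K) k c y :
  (k <= n)%N -> mixed_per A k (fun i => c * y i) = c ^+ k * mixed_per A k y.
Proof.
move=> kn; rewrite mulr_sumr; apply: eq_bigr => s _.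
have -> : c ^+ k = \prod_(i | (s i < k)%N) c.
  by rewrite prodr_const -sum1_card card_perm_lt.
rewrite [X in _ = X * _]big_mkcond -big_split /=.
by apply: eq_bigr => i _; case: ifP; rewrite ?mul1r.
Qed.

(** The restriction to the line y + t a, built as a formal polynomial in t so that factorisation
    over a closed field and the formal derivative apply. *)
Definition mixed_per_line (K : comNzRingType) n (A : 'I_n -> 'I_n -> K) k
    (y a : 'I_n -> K) : {poly K} :=
  mixed_per (fun i j => (A i j)%:P) k (fun i => (y i)%:P + a i *: 'X).

Lemma horner_mixed_per_line (K : comNzRingType) n (A : 'I_n -> 'I_n -> K) k y a t :
  (mixed_per_line A k y a).[t] = mixed_per A k (fun i => y i + t * a i).
Proof.
rewrite horner_sum; apply: eq_bigr => s _; rewrite horner_prod.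
by apply: eq_bigr => i _; case: ifP; rewrite !hornerE // mulrC.
Qed.

Lemma horner_deriv_prod (K : comNzRingType) (I : finType) (p : I -> {poly K}) x :
  (\prod_i p i)^`().[x] =
  \sum_m (p m)^`().[x] * \prod_(i | i != m) (p i).[x].
Proof.
move: (index_enum_uniq I); elim: (index_enum I) => [|a r IH] /=.
  by rewrite !big_nil derivC horner0.
case/andP=> ar ur; rewrite !big_cons derivM hornerD !hornerM IH // eqxx /=.
congr (_ * _ + _).
  rewrite horner_prod big_seq_cond [RHS]big_seq_cond.
  apply: eq_bigl => i; rewrite andbT; case: (boolP (i \in r)) => //= ir.
  by apply/esym; apply: contraNneq ar => <-.
rewrite mulr_sumr !big_seq; apply: eq_bigr => m mr.
rewrite big_cons; case: eqP => [am|_]; first by rewrite am mr in ar.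
by rewrite mulrCA.
Qed.

(** By the Leibniz rule one row, matched to some column j <= k, gets the entry [A i k]. Exchanging
    the labels j and k makes it the row matched to column k, so each of the k + 1 values of j
    contributes the same sum. *)
Lemma deriv_mixed_per_line (K : comNzRingType) n (A : 'I_n -> 'I_n -> K)
    (k : 'I_n) y :
  (mixed_per_line A k.+1 y (fun i => A i k))^`().[0] =
  k.+1%:R * mixed_per A k y.
Proof.
rewrite /mixed_per_line /mixed_per raddf_sum /= horner_sum.
pose T (s : 'S_n) (j : 'I_n) : K :=
  A ((s^-1)%g j) k * \prod_(i | i != (s^-1)%g j)
    (if (s i < k.+1)%N then y i else A i (s i)).
have Ts (s : 'S_n) : ((\prod_i (if (s i < k.+1)%N then (y i)%:P + A i k *: 'X
    else (A i (s i))%:P))^`()).[0] = \sum_(j : 'I_n | (j < k.+1)%N) T s j.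
  rewrite horner_deriv_prod (reindex_inj (@perm_inj _ (s^-1)%g)) /=.
  rewrite [RHS]big_mkcond /=; apply: eq_bigr => j _; rewrite permKV.
  case: ifP => _; last by rewrite derivC horner0 mul0r.
  rewrite derivD derivC derivZ derivX add0r hornerZ hornerC mulr1; congr (_ * _).
  by apply: eq_bigr => i _; case: ifP; rewrite !hornerE.
under eq_bigr do rewrite Ts.
rewrite exchange_big /=.
rewrite (eq_bigr (fun=> mixed_per A k y)); last first.
  move=> j jk; rewrite (reindex_inj (@mulIg _ (tperm j k))) /=.
  apply: eq_bigr => s _; rewrite /T invMg tpermV permM tpermL.
  rewrite [RHS](bigD1 ((s^-1)%g k)) //= permKV ltnn; congr (_ * _).
  apply: eq_bigr => i ik; rewrite permM; have sik : s i != k.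
    by apply: contraNneq ik => <-; rewrite permK.
  have lts : (s i < k.+1)%N = (s i < k)%N.
    by rewrite ltnS leq_eqVlt (negbTE sik : (s i == k :> nat) = false).
  case: tpermP => [sij|sik'|sij _]; first by rewrite -lts sij jk ltnSn.
    by rewrite sik' eqxx in sik.
  by rewrite lts.
rewrite sumr_const mulr_natl -{1}sum1_card.
by rewrite (@big_ord_narrow _ _ _ _ _ _ (ltn_ord k)) sum1_card card_ord.
Qed.

Lemma size_lead_linear_prod (K : idomainType) n (A : 'I_n -> 'I_n -> K) k y a
    (s : 'S_n) (q := \prod_i (if (s i < k)%N then (y i)%:P + a i *: 'X
                              else (A i (s i))%:P)) :
  (k <= n)%N -> (forall i, a i != 0) -> (forall i j, A i j != 0) ->
  size q = k.+1 /\ q`_k = \prod_i (if (s i < k)%N then a i else A i (s i)).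
Proof.
move=> kn a0 A0; rewrite {}/q.
pose q i := if (s i < k)%N then (y i)%:P + a i *: 'X else (A i (s i))%:P.
have qs i : size (q i) = (1 + (s i < k))%N.
  rewrite /q; case: ifP => _; last by rewrite size_polyC A0.
  by rewrite addrC size_polyDl size_scale // size_polyX // size_polyC; case: (_ != _).
have ql i : lead_coef (q i) = if (s i < k)%N then a i else A i (s i).
  rewrite /lead_coef qs /q; case: ifP => _; last by rewrite coefC.
  by rewrite coefD coefC coefZ coefX add0r mulr1.
have q0 i : q i != 0 by rewrite -size_poly_gt0 qs.
have sq : size (\prod_i q i) = k.+1.
  rewrite size_prod //; under eq_bigr do rewrite qs.
  rewrite big_split /= sum1_card card_ord.
  rewrite (eq_bigr (fun i => if (s i < k)%N then 1%N else 0%N)); last first.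
    by move=> i _; case: ifP.
  by rewrite -big_mkcond card_perm_lt // -addnS addKn.
split=> //; under [RHS]eq_bigr do rewrite -ql.
by rewrite -lead_coef_prod /lead_coef sq.
Qed.

(** Every product has exactly k linear factors. Since the top coefficient is itself a value of
    [mixed_per], stability at a positive a certifies the exact degree. *)
Lemma lead_mixed_per_line (K : idomainType) n (A : 'I_n -> 'I_n -> K) k y a :
  (k <= n)%N -> (forall i, a i != 0) -> (forall i j, A i j != 0) ->
  (mixed_per_line A k y a)`_k = mixed_per A k a.
Proof.
move=> kn a0 A0; rewrite coef_sum; apply: eq_bigr => s _.
by have [] := size_lead_linear_prod y s kn a0 A0.
Qed.

Lemma size_mixed_per_line (K : idomainType) n (A : 'I_n -> 'I_n -> K) k y a :
  (k <= n)%N -> (forall i, a i != 0) -> (forall i j, A i j != 0) ->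
  (size (mixed_per_line A k y a) <= k.+1)%N.
Proof.
move=> kn a0 A0; apply: leq_trans (size_sum _ _ _) _; apply/bigmax_leqP => s _.
by have [->] := size_lead_linear_prod y s kn a0 A0.
Qed.

(** * Half-plane stability and its preservation under differentiation *)

Lemma deriv0_prod_XsubC (F : fieldType) (rs : seq F) : 0 \notin rs ->
  (\prod_(z <- rs) ('X - z%:P))^`().[0] =
  (\prod_(z <- rs) ('X - z%:P)).[0] * \sum_(z <- rs) - z^-1.
Proof.
elim: rs => [|z rs IH]; first by rewrite !big_nil derivC horner0 mulr0.
rewrite inE negb_or eq_sym => /andP[z0 /IH {}IH].
rewrite !big_cons derivM derivXsubC mul1r hornerD !hornerM IH hornerXsubC.
by field.
Qed.

Lemma horner_prod_XsubC (F : fieldType) (rs : seq F) t : 0 \notin rs ->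
  (\prod_(z <- rs) ('X - z%:P)).[t] =
  (\prod_(z <- rs) ('X - z%:P)).[0] * \prod_(z <- rs) (1 - t / z).
Proof.
elim: rs => [|z rs IH]; first by rewrite !big_nil !hornerC mulr1.
rewrite inE negb_or eq_sym => /andP[z0 /IH {}IH].
by rewrite !big_cons !hornerM IH !hornerXsubC; field.
Qed.

Lemma Re_gt0 (C : numClosedFieldType) (x : C) : 0 < x -> 'Re x = x.
Proof. by move=> x0; apply/Creal_ReP; apply: gtr0_real. Qed.

(** Hurwitz stability in y. The right half-plane contains the positive vectors, in particular the
    columns of a positive matrix. *)
Definition half_plane_stable (C : numClosedFieldType) n (A : 'I_n -> 'I_n -> C) k :=
  forall y, (forall i, 0 < 'Re (y i)) -> mixed_per A k y != 0.

(** If 0 <= Re z, then y + z a, with a the positive column k, has positive real parts and is not a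
    zero; so all roots lie in the left half-plane. The leading coefficient is the value at a,
    non-zero by stability, hence there are exactly k + 1 roots. *)
Lemma stable_line_roots (C : numClosedFieldType) n (A : 'I_n -> 'I_n -> C)
    (k : 'I_n) y (R := mixed_per_line A k.+1 y (fun i => A i k)) :
    (forall i j, 0 < A i j) -> half_plane_stable A k.+1 ->
    (forall i, 0 < 'Re (y i)) ->
  exists rs : seq C,
    [/\ size rs = k.+1, 0 \notin rs, {in rs, forall z, 'Re z < 0},
        {in rs, forall z, R.[z] = 0} &
    [/\ R.[0] != 0,
        (forall t, R.[t] = R.[0] * \prod_(z <- rs) (1 - t / z)) &
        R^`().[0] = R.[0] * \sum_(z <- rs) - z^-1]].
Proof.
move=> A_gt0 stA y_gt0.
have A_neq0 i j : A i j != 0 by rewrite gt_eqF.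
have R0 : R.[0] != 0.
  rewrite horner_mixed_per_line (eq_mixed_per _ _ (z := y)) ?stA // => i.
  by rewrite mul0r addr0.
have Rn0 : R != 0 by apply: contraNneq R0 => ->; rewrite horner0.
have sR : size R = k.+2.
  apply/eqP; rewrite eqn_leq size_mixed_per_line //=.
  rewrite ltnNge; apply/negP => /leq_sizeP /(_ k.+1 (leqnn _)).
  rewrite lead_mixed_per_line // => A0.
  have /eqP[//] : mixed_per A k.+1 (fun i => A i k) != 0.
  by apply: stA => i; rewrite Re_gt0.
have [rs Rrs] := closed_field_poly_normal R.
have lR : lead_coef R != 0 by rewrite lead_coef_eq0.
have root_rs z : z \in rs -> R.[z] = 0.
  move=> zrs; rewrite Rrs hornerZ; apply/eqP.
  by rewrite mulf_eq0 -/(root _ _) root_prod_XsubC zrs orbT.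
have Re_rs z : z \in rs -> 'Re z < 0.
  move=> /root_rs /eqP; rewrite horner_mixed_per_line => Rz.
  rewrite real_ltNge ?real0 ?Creal_Re //; apply: contraL Rz => z0.
  apply: stA => i; rewrite raddfD /= ReMr ?gtr0_real //.
  by rewrite ltr_wpDr // mulr_ge0 // ltW.
have rs0 : 0 \notin rs by apply/negP => /Re_rs; rewrite raddf0 ltxx.
exists rs; split => //; last split => //.
- by apply/eqP; rewrite -eqSS -sR Rrs size_scale // size_prod_XsubC.
- by move=> t; rewrite Rrs !hornerZ horner_prod_XsubC // mulrA.
- by rewrite Rrs derivZ !hornerZ deriv0_prod_XsubC // mulrA.
Qed.

(** Logarithmic differentiation as in the Gauss-Lucas theorem: R'(0)/R(0) is the sum of -1/z over
    roots z with Re z < 0, so its real part is positive, and R'(0) is a multiple of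
    [mixed_per A k y]. *)
Lemma stable_step (C : numClosedFieldType) n (A : 'I_n -> 'I_n -> C) (k : 'I_n) :
  (forall i j, 0 < A i j) -> half_plane_stable A k.+1 -> half_plane_stable A k.
Proof.
move=> A_gt0 stA y y_gt0.
have [rs [srs rs0 Re_rs _ [R0 _]]] := stable_line_roots A_gt0 stA y_gt0.
rewrite deriv_mixed_per_line => dR.
suff : k.+1%:R * mixed_per A k y != 0 by rewrite mulf_eq0 negb_or => /andP[].
rewrite {}dR mulf_neq0 //.
suff /gt_eqF S0 : 0 < 'Re (\sum_(z <- rs) - z^-1).
  by apply: contraFneq S0 => ->; rewrite raddf0.
have ReN z : z \in rs -> 0 < 'Re (- z^-1).
  move=> zrs; rewrite raddfN /= ReV -mulNr divr_gt0 ?oppr_gt0 ?Re_rs //.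
  by rewrite exprn_gt0 // normr_gt0; apply: contraNneq rs0 => <-.
case: rs srs {rs0 Re_rs} ReN => // z rs _ ReN.
rewrite big_cons raddfD raddf_sum /= ltr_wpDr ?ReN ?mem_head //.
by rewrite big_seq sumr_ge0 // => w wrs; rewrite ltW // ReN // inE wrs orbT.
Qed.

Lemma mixed_per_full (K : comNzRingType) n (A : 'I_n -> 'I_n -> K) y :
  mixed_per A n y = n`!%:R * \prod_i y i.
Proof.
transitivity (\sum_(s : 'S_n) \prod_i y i).
  by apply: eq_bigr => s _; apply: eq_bigr => i _; rewrite ltn_ord.
by rewrite sumr_const card_Sn mulr_natl.
Qed.

Lemma half_plane_stableT (C : numClosedFieldType) n (A : 'I_n -> 'I_n -> C) k :
  (forall i j, 0 < A i j) -> (k <= n)%N -> half_plane_stable A k.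
Proof.
move=> A_gt0 kn; rewrite -(subKn kn); elim: (n - k)%N (leq_subr k n) => [|d IH] dn.
  rewrite subn0 => y y_gt0; rewrite mixed_per_full mulf_neq0 ?pnatr_eq0 -?lt0n ?fact_gt0 //.
  apply/prodf_neq0 => i _; apply: contraTneq (y_gt0 i) => ->.
  by rewrite raddf0 ltxx.
have kn' : (n - d.+1 < n)%N by rewrite subnSK // leq_subr.
apply: (stable_step (k := Ordinal kn') A_gt0) => /=.
by rewrite subnSK //; apply: IH; apply: ltnW.
Qed.

(** A lower bound on Gurvits' capacity, the infimum over positive x of the polynomial divided by the
    product of its variables, phrased as an inequality to avoid the infimum. *)
Definition capacity_ge (C : numClosedFieldType) n (A : 'I_n -> 'I_n -> C) k c :=
  forall x : 'I_n -> C, (forall j, 0 < x j) ->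
  c * \prod_(j < n | (j < k)%N) x j <=
  mixed_per A k (fun i => \sum_(j < n | (j < k)%N) A i j * x j).

Lemma sum_ord_ltS (V : nmodType) n (k : 'I_n) (F : 'I_n -> V) :
  \sum_(j < n | (j < k.+1)%N) F j = F k + \sum_(j < n | (j < k)%N) F j.
Proof.
rewrite (bigD1 k) //=; congr (_ + _); apply: eq_bigl => j.
by rewrite ltnS [in RHS]ltn_neqAle andbC.
Qed.

Lemma prod_ord_ltS (V : comNzRingType) n (k : 'I_n) (F : 'I_n -> V) :
  \prod_(j < n | (j < k.+1)%N) F j = F k * \prod_(j < n | (j < k)%N) F j.
Proof.
rewrite (bigD1 k) //=; congr (_ * _); apply: eq_bigl => j.
by rewrite ltnS [in RHS]ltn_neqAle andbC.
Qed.

Lemma mixed_per_ge0 (C : numDomainType) n (A : 'I_n -> 'I_n -> C) k y :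
  (forall i j, 0 <= A i j) -> (forall i, 0 <= y i) -> 0 <= mixed_per A k y.
Proof.
move=> A0 y0; apply: sumr_ge0 => s _; apply: prodr_ge0 => i _.
by case: ifP.
Qed.

(* For z = u + iv with v <> 0 the point y + z a is, up to the scalar -/+ i,
   in the right half-plane, so by homogeneity it is not a zero. *)
Lemma real_root_line (C : numClosedFieldType) n (A : 'I_n -> 'I_n -> C)
    k (y a : 'I_n -> C) z :
  half_plane_stable A k -> (k <= n)%N ->
  (forall i, 0 < y i) -> (forall i, 0 < a i) ->
  mixed_per A k (fun i => y i + z * a i) = 0 -> z \is Num.real.
Proof.
move=> stA kn y0 a0 Rz; apply/Creal_ImP; apply/eqP.
apply: contraT => Imz.
have [c [c0 cz]] : exists c : C, c != 0 /\ forall i, 0 < 'Re (c * (y i + z * a i)).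
  have ImE i : 'Im (y i + z * a i) = 'Im z * a i.
    rewrite raddfD /= (Creal_ImP _ (gtr0_real (y0 i))) add0r.
    by rewrite ImMr // gtr0_real.
  have := real_neqr_lt (Creal_Im z) (real0 C); rewrite Imz => /esym/orP[Im_lt|Im_gt].
    exists 'i; split; first exact: neq0Ci.
    by move=> i; rewrite ReMil ImE oppr_gt0 nmulr_rlt0.
  exists (- 'i); split; first by rewrite oppr_eq0 neq0Ci.
  by move=> i; rewrite mulNr raddfN /= ReMil ImE opprK mulr_gt0.
by have /negP[] := stA _ cz; rewrite mixed_perZ // Rz mulr0.
Qed.

Lemma prod_le_mean (C : numFieldType) (rs : seq C) (F : C -> C) :
  {in rs, forall z, 0 <= F z} ->
  \prod_(z <- rs) F z <= ((\sum_(z <- rs) F z) / (size rs)%:R) ^+ size rs.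
Proof.
move=> F0; rewrite !(big_tnth _ _ rs).
have F0' : {in predT, forall i, 0 <= F (tnth (in_tuple rs) i)}.
  by move=> i _; apply: F0; apply: mem_tnth.
have [+ _] := leif_AGM F0'; by rewrite card_ord.
Qed.

(* Gurvits' one-variable inequality: for R(t) = R(0) prod_z (1 - t/z) with
   negative roots, the arithmetic-geometric mean inequality at
   t = R(0) / R'(0) bounds R(t) / t by ((m + 1) / m)^m R'(0). *)
Lemma negative_roots_line (C : numFieldType) (rs : seq C) m (r c : C)
    (s := \sum_(z <- rs) - z^-1) :
  size rs = m.+1 -> {in rs, forall z, z < 0} -> 0 <= r ->
  (forall t, 0 < t -> c * t <= r * \prod_(z <- rs) (1 - t / z)) ->
  c * m.+1%:R ^+ m.+1 <= r * s * m.+2%:R ^+ m.+1.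
Proof.
move=> srs rs0 r0 rc.
have s0 : 0 < s.
  rewrite /s; case: rs srs rs0 {rc s} => // z rs _ rs0.
  rewrite big_cons ltr_wpDr ?oppr_gt0 ?invr_lt0 ?rs0 ?mem_head //.
  rewrite big_seq sumr_ge0 // => w wrs.
  by rewrite oppr_ge0 invr_le0 ltW // rs0 // inE wrs orbT.
have /rc := s0; have /rc {}rc : 0 < s^-1 by rewrite invr_gt0.
move=> _; have : \prod_(z <- rs) (1 - s^-1 / z) <= (m.+2%:R / m.+1%:R) ^+ m.+1.
  rewrite -srs; apply: le_trans (prod_le_mean _) _.
    move=> z /rs0 z0; rewrite subr_ge0 (le_trans _ ler01) //.
    by apply: mulr_ge0_le0; rewrite ?invr_ge0 ?invr_le0 ltW.
  rewrite big_split /= big_const_seq count_predT iter_addr_0 srs.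
  have -> : \sum_(z <- rs) - (s^-1 / z) = 1.
    under eq_bigr do rewrite -mulrN.
    by rewrite -mulr_sumr mulVf // gt_eqF.
  by rewrite natr1.
move=> /(ler_wpM2l r0) /(le_trans rc) {}rc.
have k0 : 0 < s * m.+1%:R ^+ m.+1 by rewrite mulr_gt0 // exprn_gt0 // ltr0n.
have s_neq0 : s != 0 by rewrite gt_eqF.
have m_neq0 : m.+1%:R ^+ m.+1 != 0 :> C by rewrite expf_neq0 // pnatr_eq0.
move: rc; rewrite -(ler_pM2r k0) expr_div_n.
set p := m.+1%:R ^+ m.+1 in k0 m_neq0 *; set q := m.+2%:R ^+ m.+1.
have -> : c / s * (s * p) = c * p by field.
by have -> : r * (q / p) * (s * p) = r * s * q by field.
Qed.

(** The shape c (k + 1)^k telescopes: the k + 1 negative roots on the line in the direction of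
    column k cost ((k + 2)/(k + 1))^(k + 1), and R'(0) carries a factor k + 1. For k = 0 the point y
    would be zero and leave the half-plane, hence 0 < k. *)
Lemma capacity_step (C : numClosedFieldType) n (A : 'I_n -> 'I_n -> C)
    (k : 'I_n) c :
  (forall i j, 0 < A i j) -> (0 < k)%N ->
  capacity_ge A k.+1 (c * k.+2%:R ^+ k.+1) ->
  capacity_ge A k (c * k.+1%:R ^+ k).
Proof.
move=> A_gt0 k0 capA x x0.
pose y i := \sum_(j < n | (j < k)%N) A i j * x j; rewrite -/y.
have y0 i : 0 < y i.
  rewrite /y (bigD1 (Ordinal (ltn_trans k0 (ltn_ord k)))) //= ltr_pwDl //.
    by rewrite mulr_gt0.
  by rewrite sumr_ge0 // => j _; rewrite mulr_ge0 // ltW.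
have stA := half_plane_stableT A_gt0 (ltn_ord k).
have Rey i : 0 < 'Re (y i) by rewrite Re_gt0.
have [rs [srs _ Re_rs root_rs [_ Rt dR]]] := stable_line_roots A_gt0 stA Rey.
have neg_rs : {in rs, forall z, z < 0}.
  move=> z zrs; have /Creal_ReP <- : z \is Num.real; last exact: Re_rs.
  apply: (real_root_line (a := fun i => A i k) stA (ltn_ord k) y0) => //.
  by rewrite -horner_mixed_per_line; apply: root_rs.
set R := mixed_per_line _ _ _ _ in Rt dR root_rs.
have R0 : 0 <= R.[0].
  rewrite horner_mixed_per_line mixed_per_ge0 // => i *; first exact: ltW.
  by rewrite mul0r addr0 ltW.
set X := \prod_(j < n | _) x j.
have := @negative_roots_line _ rs k R.[0] (c * k.+2%:R ^+ k.+1 * X) srs neg_rs R0.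
rewrite -dR deriv_mixed_per_line => H.
have {H} : c * k.+2%:R ^+ k.+1 * X * k.+1%:R ^+ k.+1 <=
    k.+1%:R * mixed_per A k y * k.+2%:R ^+ k.+1.
  apply: H => t t0; rewrite -Rt horner_mixed_per_line.
  (* A new variable t on column k turns the hypothesis into the linear lower bound on R(t) that the
     one-variable inequality asks for. *)
  pose x' j := if j == k then t else x j.
  have x'E (j : 'I_n) : (j < k)%N -> x' j = x j.
    by rewrite /x'; case: eqP => // ->; rewrite ltnn.
  have -> : c * k.+2%:R ^+ k.+1 * X * t =
      c * k.+2%:R ^+ k.+1 * \prod_(j < n | (j < k.+1)%N) x' j.
    by rewrite prod_ord_ltS (eq_bigr x) // /x' eqxx [t * _]mulrC mulrA.
  rewrite (eq_mixed_per _ _ (z := fun i => \sum_(j < n | (j < k.+1)%N) A i j * x' j)).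
    by apply: capA => j; rewrite /x'; case: ifP.
  move=> i; rewrite sum_ord_ltS /x' eqxx addrC [t * _]mulrC; congr (_ + _).
  by apply: eq_bigr => j jk; rewrite -/(x' j) x'E.
have p0 : 0 < k.+2%:R ^+ k.+1 * k.+1%:R :> C.
  by rewrite mulr_gt0 ?exprn_gt0 ?ltr0n.
rewrite [k.+1%:R ^+ k.+1]exprS -[_ <= mixed_per _ _ _](ler_pM2r p0).
set P := _ ^+ k.+1; set q := _ ^+ k; set a := k.+1%:R; set m := mixed_per _ _ _.
have -> : c * P * X * (a * q) = c * q * X * (P * a) by ring.
by have -> : a * m * P = m * (P * a) by ring.
Qed.

Lemma per_ge_capacity (C : numClosedFieldType) n (A : 'I_n -> 'I_n -> C) c :
  (0 < n)%N -> (forall i j, 0 < A i j) -> 0 <= c ->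
  (forall x : 'I_n -> C, (forall j, 0 < x j) ->
     c * \prod_j x j <= \prod_i \sum_j A i j * x j) ->
  c * n`!%:R <= n.+1%:R ^+ n * \sum_(s : 'S_n) \prod_i A i (s i).
Proof.
move=> n0 A_gt0 c0 cA.
(* Chosen so that e (n + 1)^n = c n!, the bound at k = n, where [mixed_per] is n! times the product
   of the row sums. *)
pose e := c * n`!%:R / n.+1%:R ^+ n.
have nn0 : 0 < n.+1%:R ^+ n :> C by rewrite exprn_gt0 ?ltr0n.
have e0 : 0 <= e by rewrite divr_ge0 ?mulr_ge0 ?ler0n // ltW.
have cap_n : capacity_ge A n (e * n.+1%:R ^+ n).
  move=> x x0; rewrite divfK ?gt_eqF // mixed_per_full [c * _]mulrC -mulrA.
  rewrite ler_wpM2l ?ler0n //.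
  have -> : \prod_(j < n | (j < n)%N) x j = \prod_j x j.
    by apply: eq_bigl => j; rewrite ltn_ord.
  apply: le_trans (cA x x0) _; rewrite le_eqVlt; apply/orP; left; apply/eqP.
  by apply: eq_bigr => i _; apply: eq_bigl => j; rewrite ltn_ord.
have cap_d d : (d < n)%N -> capacity_ge A (n - d) (e * (n - d).+1%:R ^+ (n - d)).
  elim: d => [|d IH] dn; first by rewrite subn0.
  have kn : (n - d.+1 < n)%N by rewrite ltn_subrL n0.
  apply: (capacity_step (k := Ordinal kn) A_gt0) => /=; first by rewrite subn_gt0.
  by rewrite subnSK ?(ltnW dn) //; apply/IH/ltnW.
have := cap_d n.-1; rewrite prednK // leqnn => /(_ isT).
have -> : (n - n.-1 = 1)%N by rewrite -subn1 subKn.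
pose j0 := Ordinal n0.
have le1 (F : 'I_n -> C) : \sum_(j < n | (j < 1)%N) F j = F j0.
  by rewrite (sum_ord_ltS j0) big_pred0 ?addr0.
(* For k = 1 and x = 1 the only substituted column is column 0 itself, so [mixed_per] is the
   permanent. The bound there is 2 e; the factor 2 is dropped. *)
move=> /(_ (fun=> 1) (fun=> ltr01)); rewrite big1_eq mulr1 expr1 => cap1.
have {cap1} : e <= \sum_(s : 'S_n) \prod_i A i (s i).
  apply: le_trans (_ : e <= e * 2) _; first by rewrite ler_peMr // ler1n.
  apply: le_trans cap1 _; rewrite le_eqVlt; apply/orP; left; apply/eqP.
  apply: eq_bigr => s _; apply: eq_bigr => i _; rewrite le1 mulr1.
  case: ifP => //; rewrite ltnS leqn0 => /eqP si; congr (A i _).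
  by apply: val_inj; rewrite /= si.
by rewrite /e ler_pdivrMr // [_ * n.+1%:R ^+ n]mulrC.
Qed.

(** * Permutations contained in a regular 0/1 matrix *)

Definition allowed_perms n (B : 'I_n -> 'I_n -> bool) : {set 'S_n} :=
  [set s : 'S_n | [forall i, B i (s i)]].

(** The permanent of the 0/1 matrix B. *)
Definition nperm n (B : 'I_n -> 'I_n -> bool) : nat := #|allowed_perms B|.

Lemma nperm_ord0 (B : 'I_0 -> 'I_0 -> bool) : nperm B = 1%N.
Proof.
rewrite /nperm -[1%N]/(0`!) -card_Sn -cardsT; congr #|pred_of_set _|.
by apply/setP => s; rewrite !inE; apply/forallP => -[].
Qed.

(** After raising to the power d, the arithmetic-geometric mean inequality on the d terms of a row
    bounds their product by the d-th power of the row sum. In the product over all rows, column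
    regularity makes each x_j occur d times. *)
Lemma regular_capacity (C : numDomainType) n (B : 'I_n -> 'I_n -> bool) d
    (x : 'I_n -> C) :
  (0 < d)%N ->
  (forall i, #|[pred j | B i j]| = d) -> (forall j, #|[pred i | B i j]| = d) ->
  (forall j, 0 <= x j) ->
  d%:R ^+ n * \prod_j x j <= \prod_i \sum_(j | B i j) x j.
Proof.
move=> d0 row_d col_d x0.
have lhs0 : 0 <= d%:R ^+ n * \prod_j x j.
  by rewrite mulr_ge0 ?exprn_ge0 ?ler0n // prodr_ge0.
rewrite -(ler_pXn2r d0) ?nnegrE //; last first.
  by apply: prodr_ge0 => i _; apply: sumr_ge0.
rewrite -prodrXl.
have -> : (d%:R ^+ n * \prod_j x j) ^+ d =
    \prod_(i < n) \prod_(j | B i j) (x j *+ d).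
  rewrite (exchange_big_dep xpredT) //= exprMn -prodrXl -exprM mulnC exprM.
  have -> : (d%:R ^+ d) ^+ n = \prod_(j < n) d%:R ^+ d :> C.
    by rewrite prodr_const card_ord.
  rewrite -big_split /=; apply: eq_bigr => j _.
  rewrite (eq_bigl (fun i => i \in [pred i | B i j])) // prodr_const col_d.
  by rewrite -[x j *+ d]mulr_natl exprMn.
apply: ler_prod => i _; apply/andP; split.
  by apply: prodr_ge0 => j _; rewrite mulrn_wge0.
have E0 : {in [pred j | B i j], forall j, 0 <= x j *+ #|[pred j | B i j]|}.
  by move=> j _; rewrite mulrn_wge0.
by have [+ _] := leif_AGM_scaled E0; rewrite row_d.
Qed.

(** For an allowed s this expands (M + 1)^n; otherwise one factor is 1 and the others are at most 2
    M. Only the allowed permutations reach order M^n. *)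
Lemma prod_perturb_le n (B : 'I_n -> 'I_n -> bool) M (s : 'S_n) :
  (0 < M)%N ->
  (\prod_i (M * B i (s i) + 1) <=
   M ^ n * [forall i, B i (s i)] + 2 ^ n * M ^ n.-1)%N.
Proof.
case: n B s => [|n] B s M0.
  rewrite big_ord0 (_ : [forall i, _] = true) ?muln1 ?ltn_addr //.
  by apply/forallP => -[].
have le2M i : (M * B i (s i) + 1 <= 2 * M)%N by case: (B i (s i)); lia.
have [allB|/forallPn[i Bi]] := boolP [forall i, B i (s i)].
  rewrite (eq_bigr (fun=> M + 1)%N); last first.
    by move=> i _; rewrite (forallP allB) muln1.
  rewrite prod_nat_const card_ord muln1 expnDn big_ord_recl /= subn0 exp1n bin0 mul1n muln1.
  rewrite leq_add2l.
  apply: (@leq_trans (\sum_(i < n.+1) M ^ n * 'C(n.+1, i.+1))).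
    apply: leq_sum => i _; rewrite exp1n muln1 mulnC leq_mul2r leq_pexp2l ?orbT //.
    by rewrite /bump add1n subSS leq_subr.
  rewrite -big_distrr /= mulnC leq_mul2r; apply/orP; right.
  rewrite -[2%N]/(1 + 1)%N expnDn [leqRHS]big_ord_recl; apply: leq_trans (leq_addl _ _).
  by apply: leq_sum => j _; rewrite !exp1n !muln1.
rewrite muln0 add0n (bigD1 i) //= (negbTE Bi) muln0 mul1n.
apply: leq_trans (_ : (2 * M) ^ n <= _)%N; last first.
  by rewrite expnMn leq_mul2r leq_pexp2l ?orbT.
have -> : ((2 * M) ^ n = \prod_(j < n.+1 | j != i) (2 * M))%N.
  by rewrite prod_nat_const cardC1 card_ord.
exact: leq_prod.
Qed.

(** M exceeds b e, so after division by M N the error is below 1 and integrality removes it. *)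
Lemma perturbation_limit (M N x b K e : nat) :
  (0 < N)%N -> M = (b * e).+1 ->
  (M * N * x <= b * (M * N * K + e * N))%N -> (x <= b * K)%N.
Proof.
move=> N0 -> H; rewrite -ltnS -(ltn_pmul2l (ltn0Sn (b * e))).
apply: (@leq_ltn_trans ((b * e).+1 * (b * K) + b * e)%N); last by lia.
rewrite -(leq_pmul2l N0); apply: leq_trans (leq_trans _ H) _; apply: eq_leq; ring.
Qed.

(* The capacity argument needs positive entries, so it is applied to the matrix
   M B + 1; as the counts are integers, a large finite M replaces a limit. *)
Lemma regular_nperm_ge n (B : 'I_n -> 'I_n -> bool) d :
  (forall i, #|[pred j | B i j]| = d) -> (forall j, #|[pred i | B i j]| = d) ->
  (d ^ n * n`! <= n.+1 ^ n * nperm B)%N.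
Proof.
move=> row_d col_d; case: (posnP d) => [->|d0].
  case: n B row_d col_d => [B _ _|n B _ _]; last by rewrite exp0n.
  by rewrite nperm_ord0.
case: (posnP n) => [n0|n0].
  by subst n; rewrite nperm_ord0.
pose M := (n.+1 ^ n * (n`! * 2 ^ n)).+1%N.
pose A i j : algC := (M * B i j + 1)%N%:R.
have capA (x : 'I_n -> algC) : (forall j, 0 < x j) ->
    (M * d)%N%:R ^+ n * \prod_j x j <= \prod_i \sum_j A i j * x j.
  move=> x0; have x0' j : 0 <= x j by apply: ltW.
  rewrite natrM exprMn -mulrA.
  apply: le_trans (ler_wpM2l _ (regular_capacity d0 row_d col_d x0')) _.
    by rewrite exprn_ge0 ?ler0n.
  have -> : M%:R ^+ n = \prod_(j < n) M%:R :> algC.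
    by rewrite prodr_const card_ord.
  rewrite -big_split /=.
  apply: ler_prod => i _; rewrite mulr_ge0 ?ler0n ?sumr_ge0 //= mulr_sumr big_mkcond.
  apply: ler_sum => j _; rewrite /A natrD natrM; case: (B i j).
    by rewrite mulr1 mulrDl lerDl mul1r.
  by rewrite mulr0 add0r mul1r.
have A_gt0 i j : 0 < A i j by rewrite ltr0n addn1.
have c0 : 0 <= (M * d)%N%:R ^+ n :> algC by rewrite -natrX ler0n.
have := per_ge_capacity n0 A_gt0 c0 capA.
have -> : \sum_(s : 'S_n) \prod_i A i (s i) =
    (\sum_(s : 'S_n) \prod_i (M * B i (s i) + 1))%N%:R.
  by rewrite natr_sum; apply: eq_bigr => s _; rewrite natr_prod.
rewrite -!natrX -!natrM ler_nat => H.
have {H} : ((M * d) ^ n * n`! <=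
    n.+1 ^ n * (M ^ n * nperm B + n`! * (2 ^ n * M ^ n.-1)))%N.
  apply: leq_trans H _; rewrite leq_mul2l; apply/orP; right.
  apply: leq_trans (leq_sum _ _) _; first by move=> s _; apply: prod_perturb_le.
  rewrite big_split /= sum_nat_const card_Sn leq_add2r -big_distrr /=.
  rewrite leq_mul2l; apply/orP; right.
  rewrite /nperm -sum1_card [leqRHS]big_mkcond; apply: leq_sum => s _.
  by rewrite inE; case: ifP.
rewrite expnMn (_ : M ^ n = M * M ^ n.-1)%N; last by rewrite -expnS prednK.
rewrite -mulnA [(n`! * (_ * _))%N]mulnA; apply: perturbation_limit => //.
by rewrite expn_gt0.
Qed.

(** * Bregman's theorem *)

(** Logarithm of Bregman's factor (r!)^(1/r). Its value 0 at r = 0, from division by zero, keeps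
    [ln_fact_rootM] valid there, as needed for r - 1 when a row has degree 1. *)
Definition ln_fact_root (R : realType) (r : nat) : R := ln (r`!%:R) / r%:R.

Lemma ln_fact_rootM (R : realType) r : r%:R * ln_fact_root R r = ln r`!%:R.
Proof.
case: r => [|r]; first by rewrite mul0r fact0 ln1.
by rewrite /ln_fact_root mulrC divfK // pnatr_eq0.
Qed.

Lemma ln_le_subr1 (R : realType) (x : R) : 0 < x -> ln x <= x - 1.
Proof.
by move=> x0; have := expR_ge1Dx (ln x); rewrite lnK ?posrE //; lra.
Qed.

(** Jensen's inequality for x ln x, from ln u <= u - 1 at u = N/(|P| t_i), summed with weights
    t_i. *)
Lemma log_sum (R : realType) (I : finType) (P : pred I) (t : I -> nat)
    (N := (\sum_(i | P i) t i)%N) :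
  N%:R * ln (N%:R : R) <=
  N%:R * ln #|P|%:R + \sum_(i | P i) (t i)%:R * ln (t i)%:R.
Proof.
have [N0|N0] := posnP N.
  rewrite N0 !mul0r add0r sumr_ge0 // => i _.
  by case: (t i) => [|m]; rewrite ?mul0r // mulr_ge0 ?ler0n // ln_ge0 // ler1n.
have P0 : (0 < #|P|)%N.
  rewrite lt0n; apply: contraTneq N0 => /card0_eq P0.
  by rewrite -leqNgt leqn0 /N big_pred0.
have r0 : 0 < #|P|%:R :> R by rewrite ltr0n.
have Npos : 0 < N%:R :> R by rewrite ltr0n.
have term i : (t i)%:R * ln (N%:R : R) <=
   (t i)%:R * ln #|P|%:R + (t i)%:R * ln (t i)%:R + (N%:R / #|P|%:R - (t i)%:R).
  have [->|ti] := posnP (t i).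
    by rewrite !mul0r subr0 !add0r divr_ge0 ?ler0n.
  have t0 : 0 < (t i)%:R :> R by rewrite ltr0n.
  have := ln_le_subr1 (divr_gt0 Npos (mulr_gt0 r0 t0)).
  rewrite ln_div ?posrE ?mulr_gt0 // lnM ?posrE // => H.
  have := ler_wpM2l (ltW t0) H.
  have -> : (t i)%:R * (N%:R / (#|P|%:R * (t i)%:R) - 1) =
    N%:R / #|P|%:R - (t i)%:R :> R by field; rewrite !gt_eqF.
  by lra.
have := ler_sum (index_enum I) (fun i (_ : P i) => term i).
rewrite -mulr_suml -natr_sum -/N !big_split /= -mulr_suml -natr_sum -/N.
rewrite sumrN -natr_sum -/N sumr_const -[_ / _ *+ _]mulr_natr divfK ?gt_eqF // subrr addr0.
exact.
Qed.

Definition force n (B : 'I_n -> 'I_n -> bool) (i l : 'I_n) (k m : 'I_n) :=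
  if k == i then m == l else B k m && (m != l).

Lemma allowed_perms_force n (B : 'I_n -> 'I_n -> bool) i l : B i l ->
  allowed_perms (force B i l) = [set s in allowed_perms B | s i == l].
Proof.
move=> Bil; apply/setP => s; rewrite !inE; apply/forallP/andP => [H|[/forallP H /eqP sil] k].
  have /eqP sil : s i == l by have := H i; rewrite /force eqxx.
  split; last by rewrite sil.
  apply/forallP => k; have := H k; rewrite /force.
  by case: eqP => [-> /eqP -> //|_ /andP[]].
rewrite /force; case: eqP => [->|/eqP ki]; first by rewrite sil.
by rewrite H -sil (inj_eq perm_inj).
Qed.

Lemma nperm_row n (B : 'I_n -> 'I_n -> bool) i :
  nperm B = (\sum_(l | B i l) nperm (force B i l))%N.
Proof.
rewrite /nperm -sum1_card.
rewrite (partition_big (fun s : 'S_n => s i) (B i)) /=; last first.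
  by move=> s; rewrite inE => /forallP.
apply: eq_bigr => l Bil; rewrite allowed_perms_force // -sum1_card.
by apply: eq_bigl => s; rewrite !inE.
Qed.

(* Rows outside F are forced: such a row allows at most one column, and that
   column is allowed in no other row.  Forcing rows one at a time replaces the
   passage to minors. *)
Lemma bregman_forced (R : realType) n (F : {set 'I_n}) (B : 'I_n -> 'I_n -> bool) :
  (forall k l, k \notin F -> B k l ->
     (forall i, i != k -> ~~ B i l) /\ (forall l', B k l' -> l' = l)) ->
  (0 < nperm B)%N ->
  ln (nperm B)%:R <= \sum_(i in F) ln_fact_root R #|[pred l | B i l]|.
Proof.
elim: {F}#|F| {-2}F (erefl #|F|) B => [|f IH] F cF B forced N0.
  move/eqP: cF; rewrite cards_eq0 => /eqP F0.
  have N1 : (nperm B <= 1)%N.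
    apply/card_le1_eqP => s s'; rewrite !inE => /forallP sB /forallP s'B.
    apply/permP => k; have [|_] := forced k (s k) _ (sB k); first by rewrite F0 inE.
    by apply.
  have -> : nperm B = 1%N by apply/eqP; rewrite eqn_leq N1.
  by rewrite ln1 F0 big_set0.
pose r i := #|[pred l | B i l]|.
pose t i l := nperm (force B i l).
set N := nperm B in N0 *.
(* Exactly [t i l] allowed permutations send i to l, so the sum of t ln t becomes a sum over allowed
   s. The sum over the rows can then be taken for each s separately. *)
have row i : N%:R * ln (N%:R : R) <=
    \sum_(s in allowed_perms B) (ln (r i)%:R + ln (t i (s i))%:R).
  have := @log_sum R _ (B i) (t i); rewrite -nperm_row -/N => /le_trans; apply.
  rewrite big_split /= sumr_const -[#|allowed_perms B|]/N [N%:R * ln _]mulr_natl lerD2l.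
  rewrite [leRHS](partition_big (fun s : 'S_n => s i) (B i)) /=; last first.
    by move=> s; rewrite inE => /forallP.
  apply: ler_sum => l Bil.
  rewrite (eq_bigr (fun=> ln (t i l)%:R)); last by move=> s /andP[_ /eqP ->].
  rewrite (eq_bigl (fun s => s \in allowed_perms (force B i l))); last first.
    by move=> s; rewrite allowed_perms_force // inE.
  by rewrite sumr_const mulr_natl.
have minor i s : i \in F -> s \in allowed_perms B ->
    ln (t i (s i))%:R <= \sum_(j in F :\ i) ln_fact_root R (r j - B j (s i)).
  move=> iF sB; have Bs k : B k (s k) by move: sB; rewrite inE => /forallP.
  have cF' : #|F :\ i| = f by apply/eqP; rewrite -eqSS -cF (cardsD1 i F) iF.
  apply: le_trans (IH _ cF' (force B i (s i)) _ _) _.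
  - move=> k l; rewrite !inE negb_and negbK /force => /orP[/eqP ->|kF].
      rewrite eqxx => /eqP ->; split; last by move=> l' /eqP.
      by move=> j /negbTE ->; rewrite eqxx andbF.
    case: eqP => [->|/eqP ki].
      move=> /eqP ->; split; last by move=> l' /eqP.
      by move=> j /negbTE ->; rewrite eqxx andbF.
    case/andP=> Bkl lsi; have [H1 H2] := forced _ _ kF Bkl; split.
      move=> j jk; case: eqP => [_|_] //.
      by rewrite negb_and H1.
    by move=> l' /andP[/H2].
  - rewrite /nperm card_gt0; apply/set0Pn; exists s.
    by rewrite allowed_perms_force // inE sB eqxx.
  rewrite le_eqVlt; apply/orP; left; apply/eqP; apply: eq_bigr => j.
  rewrite !inE => /andP[ji jF]; congr ln_fact_root.
  rewrite /r (cardD1 (s i) [pred l | B j l]) inE addKn.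
  by apply: eq_card => l; rewrite !inE /force (negbTE ji) andbC.
(* Write phi for [ln_fact_root R] and fix s and a row j of F of degree r. Exactly r - 1 rows i != j
   of F have [B j (s i)] and leave row j with degree r - 1; the other f + 1 - r leave degree r.
   Since ln r + ln (r - 1)! = ln r!, the total ln r + (r - 1) phi(r - 1) + (f + 1 - r) phi(r) equals
   (f + 1) phi(r). *)
have sumF s : s \in allowed_perms B ->
    \sum_(i in F) (ln (r i)%:R + ln (t i (s i))%:R) <=
    f.+1%:R * \sum_(j in F) ln_fact_root R (r j).
  move=> sB; have Bs k : B k (s k) by move: sB; rewrite inE => /forallP.
  apply: (@le_trans _ _ (\sum_(i in F) (ln (r i)%:R +
    \sum_(j in F :\ i) ln_fact_root R (r j - B j (s i))))).
    by apply: ler_sum => i iF; rewrite lerD2l minor.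
  rewrite big_split /= [X in _ + X](exchange_big_dep (mem F)) /=; last first.
    by move=> i j _; rewrite inE => /andP[].
  rewrite -big_split /= mulr_sumr; apply: ler_sum => j jF.
  have rj0 : (0 < r j)%N by apply/card_gt0P; exists (s j); rewrite inE.
  rewrite (bigID (fun i => B j (s i))) /=.
  rewrite (eq_bigr (fun=> ln_fact_root R (r j).-1)); last first.
    by move=> i /andP[_ ->]; rewrite subn1.
  rewrite [X in _ + (_ + X)](eq_bigr (fun=> ln_fact_root R (r j))); last first.
    by move=> i /andP[_ /negbTE ->]; rewrite subn0.
  rewrite !sumr_const -![ln_fact_root _ _ *+ _]mulr_natl.
  have cr : #|[pred i | B j (s i)]| = r j.
    rewrite /r -(fintype.card_image (@perm_inj _ s) [pred i | B j (s i)]).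
    apply: eq_card => l; apply/fintype.imageP/idP => [[i Bi ->] //|Bl].
    by exists ((s^-1)%g l); rewrite ?inE permKV.
  have inF i : B j (s i) -> i \in F.
    move=> Bi; apply: contraT => iF; have [/(_ j)] := forced _ _ iF (Bs i).
    by rewrite Bi; case: eqP => [ji|_ /(_ isT) //]; rewrite -ji jF in iF.
  have c1 : #|[pred i | (i \in F) && (j \in F :\ i) && B j (s i)]| = (r j).-1.
    rewrite -cr (cardD1 j [pred i | B j (s i)]) inE Bs /=.
    apply: eq_card => i; rewrite !inE jF andbT eq_sym.
    case: (boolP (B j (s i))) => [Bi|_]; last by rewrite !andbF.
    by rewrite inF.
  have c2 : (#|[pred i | (i \in F) && (j \in F :\ i) && ~~ B j (s i)]| + r j = f.+1)%N.
    rewrite -cF -(cardID [pred i | B j (s i)] F) addnC -cr; congr (_ + _)%N.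
      apply: eq_card => i; rewrite !inE.
      by case: (boolP (B j (s i))) => [/inF ->|]; rewrite ?andbF.
    apply: eq_card => i; rewrite !inE jF andbT andbC.
    case: eqP => [<-|_]; first by rewrite Bs.
    by rewrite andbT.
  rewrite [X in X%:R * _ + _](_ : _ = (r j).-1); last first.
    by rewrite -c1; apply: eq_card.
  set m := (X in _ + (_ + X%:R * _) <= _).
  have <- : (m + r j = f.+1)%N by rewrite -c2; congr (_ + _)%N; apply: eq_card.
  rewrite natrD mulrDl !ln_fact_rootM addrA [leRHS]addrC lerD2r.
  rewrite -lnM ?posrE ?ltr0n ?fact_gt0 // -natrM -[in leLHS](prednK rj0).
  by rewrite -factS prednK.
have : f.+1%:R * (N%:R * ln (N%:R : R)) <=
    f.+1%:R * (N%:R * \sum_(j in F) ln_fact_root R (r j)).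
  rewrite mulr_natl -cF -sumr_const.
  apply: le_trans (ler_sum _ (fun i _ => row i)) _.
  rewrite exchange_big /= mulrCA.
  apply: le_trans (ler_sum _ (fun s sB => sumF s sB)) _.
  by rewrite sumr_const [leRHS]mulr_natl cF.
by rewrite ler_pM2l ?ltr0n // ler_pM2l ?ltr0n.
Qed.

Lemma bregman (R : realType) n (B : 'I_n -> 'I_n -> bool) :
  (0 < nperm B)%N ->
  ln (nperm B)%:R <= \sum_i ln_fact_root R #|[pred l | B i l]|.
Proof.
move=> N0; have := @bregman_forced R n [set: 'I_n]%SET B _ N0.
by under eq_bigl do rewrite inE; apply => k l; rewrite inE.
Qed.

(** * Counting Latin squares *)

Definition extension n (Q : nat -> 'I_n -> 'I_n -> bool) (w : seq 'S_n)
    (j v : 'I_n) : bool :=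
  Q (size w) j v && all (fun u : 'S_n => u j != v) w.

(* Latin rectangles as lists of rows, the most recently added row first; the
   k-th row added takes in column j only symbols v with Q k j v. *)
Fixpoint rectangles n (Q : nat -> 'I_n -> 'I_n -> bool) (m : nat) : seq (seq 'S_n) :=
  if m is m'.+1 then
    [seq t :: w | w <- rectangles Q m', t <- enum (allowed_perms (extension Q w))]
  else [:: [::]].

Lemma rectanglesP n (Q : nat -> 'I_n -> 'I_n -> bool) m (t : 'S_n) w :
  reflect (w \in rectangles Q m /\ forall j, extension Q w j (t j))
          (t :: w \in rectangles Q m.+1).
Proof.
apply: (iffP allpairsPdep) => [[w' [t' [w'm]]]|[wm wt]].
  by rewrite mem_enum inE => /forallP H [-> ->].
by exists w, t; split => //; rewrite mem_enum inE; apply/forallP.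
Qed.

Lemma size_rectangles n (Q : nat -> 'I_n -> 'I_n -> bool) m w :
  w \in rectangles Q m -> size w = m.
Proof.
elim: m w => [|m IH] w; first by rewrite inE => /eqP ->.
case: w => [/allpairsPdep[? [? []]] //|t w /rectanglesP[wm _]].
by rewrite /= (IH w).
Qed.

Lemma uniq_rectangles n (Q : nat -> 'I_n -> 'I_n -> bool) m :
  uniq (rectangles Q m).
Proof.
elim: m => //= m IH; apply: allpairs_uniq_dep => //.
  by move=> w _; apply: enum_uniq.
by move=> [w t] [w' t'] _ _ /= [-> ->].
Qed.

Lemma size_rectanglesS n (Q : nat -> 'I_n -> 'I_n -> bool) m :
  size (rectangles Q m.+1) =
  (\sum_(w <- rectangles Q m) nperm (extension Q w))%N.
Proof.
rewrite size_allpairs_dep sumnE big_map; apply: eq_bigr => w _.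
by rewrite -cardE.
Qed.

Lemma uniq_rectangle_column n (Q : nat -> 'I_n -> 'I_n -> bool) m w j :
  w \in rectangles Q m -> uniq [seq (u : 'S_n) j | u <- w].
Proof.
elim: m w => [|m IH] w; first by rewrite inE => /eqP ->.
case: w => [//|t w /rectanglesP[wm wt]] /=; rewrite (IH w) // andbT.
apply/mapP => -[u uw tu]; have /andP[_ /allP/(_ u uw)] := wt j.
by rewrite tu eqxx.
Qed.

(** The dual of the column statement: each symbol has been used in m different columns, which gives
    regularity on the symbol side. *)
Lemma uniq_rectangle_symbol n (Q : nat -> 'I_n -> 'I_n -> bool) m w v :
  w \in rectangles Q m -> uniq [seq (u^-1)%g v | u : 'S_n <- w].
Proof.
elim: m w => [|m IH] w; first by rewrite inE => /eqP ->.
case: w => [//|t w /rectanglesP[wm wt]] /=; rewrite (IH w) // andbT.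
apply/mapP => -[u uw tu]; have /andP[_ /allP/(_ u uw)] := wt ((t^-1)%g v).
by rewrite permKV tu permKV eqxx.
Qed.

Lemma card_notin_uniq (T : finType) (s : seq T) :
  uniq s -> #|[pred x | x \notin s]| = (#|T| - size s)%N.
Proof.
move=> us; rewrite -(card_uniqP us) -(cardC (mem s)) addKn.
by apply: eq_card => x; rewrite !inE.
Qed.

Definition no_constraint n (k : nat) (j v : 'I_n) := true.

Lemma latin_rectangles_ge n m : (m <= n)%N ->
  ((n ^_ m) ^ n * n`! ^ m <=
   (n.+1 ^ n) ^ m * size (rectangles (@no_constraint n) m))%N.
Proof.
elim: m => [|m IH] mn; first by rewrite ffactn0 exp1n !expn0.
have {}IH := IH (ltnW mn).
apply: (@leq_trans ((n.+1 ^ n) ^ m * (size (rectangles (@no_constraint n) m) *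
    ((n - m) ^ n * n`!)))%N).
  by rewrite ffactnSr expnMn expnSr mulnACA [leqRHS]mulnA; apply: leq_mul.
rewrite expnSr -mulnA leq_mul2l; apply/orP; right.
rewrite size_rectanglesS big_distrr /= -sum1_size big_distrl /= !big_seq.
apply: leq_sum => w wm; rewrite mul1n; apply: regular_nperm_ge => [j|v].
  have := card_notin_uniq (uniq_rectangle_column j wm).
  rewrite card_ord size_map (size_rectangles wm) => <-.
  apply: eq_card => v; rewrite !inE /extension /=.
  apply/allP/idP => [H|H u uw].
    by apply/mapP => -[u uw vu]; have := H u uw; rewrite vu eqxx.
  by apply: contra H => /eqP <-; apply: map_f.
have := card_notin_uniq (uniq_rectangle_symbol v wm).
rewrite card_ord size_map (size_rectangles wm) => <-.
apply: eq_card => j; rewrite !inE /extension /=.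
apply/allP/idP => [H|H u uw].
  by apply/mapP => -[u uw vu]; have := H u uw; rewrite vu permKV eqxx.
by apply: contra H => /eqP <-; apply/mapP; exists u; rewrite ?permK.
Qed.

Definition array_of_rows n (w : seq 'S_n) : array n :=
  [ffun p : 'I_n * 'I_n => nth 1%g w p.1 p.2].

Lemma card_latin_squares_ge n :
  (n`! ^ n * n`! ^ n <= (n.+1 ^ n) ^ n * #|latin_squares n|)%N.
Proof.
have := latin_rectangles_ge (leqnn n); rewrite ffactnn => /leq_trans; apply.
rewrite leq_mul2l; apply/orP; right.
rewrite -(size_map (@array_of_rows n)) cardE; apply: uniq_leq_size.
  rewrite map_inj_in_uniq ?uniq_rectangles // => w w' wn w'n E.
  apply: (@eq_from_nth _ 1%g); first by rewrite (size_rectangles wn) (size_rectangles w'n).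
  move=> i; rewrite (size_rectangles wn) => i_n; apply/permP => j.
  by have := congr1 (fun L : array n => L (Ordinal i_n, j)) E; rewrite !ffunE.
move=> _ /mapP[w wn ->]; rewrite mem_enum inE; apply/asboolP; split => [i|j].
  by apply: injF_bij => j j'; rewrite !ffunE; apply: perm_inj.
apply: injF_bij => i i'; rewrite !ffunE /= => E; apply: ord_inj; apply/eqP.
have lt_w (k : 'I_n) : (k < size w)%N by rewrite (size_rectangles wn).
rewrite -(nth_uniq ((1%g : 'S_n) j) _ _ (uniq_rectangle_column j wn)) ?size_map ?lt_w //.
by rewrite !(nth_map 1%g) ?lt_w // E.
Qed.

(** * Latin squares with a prescribed empty box *)

Definition row_perm_of n (L : array n) (i : 'I_n) : 'S_n :=
  odflt 1%g [pick s : 'S_n | [forall j, s j == L (i, j)]].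

Lemma row_perm_ofE n (L : array n) i j : latin L -> row_perm_of L i j = L (i, j).
Proof.
move=> [rowL _]; rewrite /row_perm_of; case: pickP => [s /forallP/(_ j)/eqP //|].
have inj : injective (fun j => L (i, j)) by apply: bij_inj.
by move=> /(_ (perm inj)) /forallP[] k; rewrite permE.
Qed.

(** The constraint refers to positions: once the rows of X are listed first, [k < #|X|] says that
    the row at position k, counted from 0, lies in X. *)
Definition avoids_box n (X Y Z : {set 'I_n}) (k : nat) (j v : 'I_n) :=
  ~~ [&& (k < #|X|)%N, j \in Y & v \in Z].

Definition rows_first n (X : {set 'I_n}) (L : array n) k : seq 'S_n :=
  rev [seq row_perm_of L i | i <- take k (enum X ++ enum (~: X))].

Lemma perm_rows_order n (X : {set 'I_n}) :
  [/\ uniq (enum X ++ enum (~: X)), size (enum X ++ enum (~: X)) = n &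
      forall i, i \in enum X ++ enum (~: X)].
Proof.
split; last by move=> i; rewrite mem_cat !mem_enum inE; case: (_ \in _).
  rewrite cat_uniq !enum_uniq andbT; apply/hasPn => i.
  by rewrite !mem_enum inE.
by rewrite size_cat -!cardE cardsC card_ord.
Qed.

Lemma rows_first_rectangle n (X Y Z : {set 'I_n}) L k :
  latin L -> empty_box L X Y Z -> (k <= n)%N ->
  rows_first X L k \in rectangles (avoids_box X Y Z) k.
Proof.
move=> latinL emptyL; have [us ss _] := perm_rows_order X.
elim: k => [|k IH] kn; first by rewrite /rows_first take0 inE.
have k_size : (k < size (enum X ++ enum (~: X)))%N by rewrite ss.
pose i := nth (Ordinal kn) (enum X ++ enum (~: X)) k.
have -> : rows_first X L k.+1 = row_perm_of L i :: rows_first X L k.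
  by rewrite /rows_first (take_nth (Ordinal kn)) // map_rcons rev_rcons.
apply/rectanglesP; split; first exact/IH/ltnW.
move=> j; rewrite /extension row_perm_ofE //.
rewrite size_rev size_map size_take k_size; apply/andP; split.
  apply/negP => /and3P[kX jY iZ]; have /negP[] := emptyL.
  apply/existsP; exists i; rewrite {1}/i nth_cat -cardE kX -mem_enum mem_nth -?cardE //=.
  by apply/existsP; exists j; rewrite jY.
apply/allP => u; rewrite mem_rev => /mapP[i' i'k ->]; rewrite row_perm_ofE //.
apply/eqP => Lij; have /bij_inj/(_ _ _ Lij) ii' := latinL.2 j.
have : uniq (take k.+1 (enum X ++ enum (~: X))) by rewrite take_uniq.
by rewrite (take_nth (Ordinal kn)) // rcons_uniq -/i -ii' i'k.
Qed.

(** The row order depends on X only, so the list of reordered rows determines L. *)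
Lemma card_empty_box_le n (X Y Z : {set 'I_n}) :
  (#|[set L in latin_squares n | empty_box L X Y Z]%SET| <=
   size (rectangles (avoids_box X Y Z) n))%N.
Proof.
have [_ ss all_s] := perm_rows_order X.
rewrite cardE -(size_map (fun L => rows_first X L n)); apply: uniq_leq_size.
  rewrite map_inj_in_uniq ?enum_uniq // => L L'.
  rewrite !mem_enum !inE => /andP[/asboolP latinL _] /andP[/asboolP latinL' _].
  move=> /(can_inj revK); rewrite !take_oversize ?ss // => /eq_in_map E.
  by apply/ffunP => -[i j]; rewrite -!row_perm_ofE // E.
move=> _ /mapP[L + ->]; rewrite mem_enum !inE => /andP[/asboolP latinL emptyL].
exact: rows_first_rectangle.
Qed.

Lemma rectangle_avoids_box n (X Y Z : {set 'I_n}) m w (u : 'S_n) j :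
  (m <= #|X|)%N -> w \in rectangles (avoids_box X Y Z) m -> u \in w -> j \in Y ->
  u j \notin Z.
Proof.
elim: m w => [|m IH] w mX; first by rewrite inE => /eqP ->.
case: w => [//|t w /rectanglesP[wm wt]]; rewrite inE => /orP[/eqP ->|uw] jY.
  have /andP[] := wt j; rewrite /avoids_box (size_rectangles wm) mX jY /=.
  by [].
exact: IH (ltnW mX) wm uw jY.
Qed.

Lemma card_avoids_box_extension n (X Y Z : {set 'I_n}) m w j :
  w \in rectangles (avoids_box X Y Z) m ->
  #|[pred v | extension (avoids_box X Y Z) w j v]| =
  (n - m - (if (m < #|X|)%N && (j \in Y) then #|Z| else 0))%N.
Proof.
move=> wm; have uj := uniq_rectangle_column j wm.
have allE v : all (fun u : 'S_n => u j != v) w = (v \notin [seq u j | u : 'S_n <- w]).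
  apply/allP/idP => [H|H u uw].
    by apply/mapP => -[u uw vu]; have := H u uw; rewrite vu eqxx.
  by apply: contra H => /eqP <-; apply: map_f.
have cE := card_notin_uniq uj; rewrite card_ord size_map (size_rectangles wm) in cE.
case: ifP => [/andP[mX jY]|mXjY].
  rewrite -cE -(cardID (mem Z) [pred v | v \notin _]).
  rewrite (_ : #|[predI _ & _]| = #|Z|) ?addKn.
    apply: eq_card => v; rewrite !inE /extension /avoids_box allE.
    by rewrite (size_rectangles wm) mX jY andbC.
  apply: eq_card => v; rewrite !inE andbC; case: (boolP (v \in Z)) => //= vZ.
  apply/mapP => -[u uw vu]; have := rectangle_avoids_box (ltnW mX) wm uw jY.
  by rewrite -vu vZ.
rewrite subn0 -cE; apply: eq_card => v; rewrite !inE /extension /avoids_box allE.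
by rewrite (size_rectangles wm) andbA mXjY.
Qed.

(** * Asymptotics *)

Lemma lnB_le (R : realType) (a b : R) : 0 < a -> 0 < b -> ln a - ln b <= a / b - 1.
Proof.
by move=> a0 b0; rewrite -ln_div ?posrE //; apply: ln_le_subr1; rewrite divr_gt0.
Qed.

Lemma lnS_ge (R : realType) r : (0 < r)%N -> ln (r%:R : R) + r.+1%:R^-1 <= ln r.+1%:R.
Proof.
move=> r0; have a0 : 0 < r%:R :> R by rewrite ltr0n.
have b0 : 0 < r.+1%:R :> R by rewrite ltr0n.
have := lnB_le a0 b0; have -> : r%:R / r.+1%:R - 1 = - r.+1%:R^-1 :> R.
  by rewrite -natr1; field; rewrite natr1 gt_eqF.
by move: (ln r%:R) (ln r.+1%:R) (r.+1%:R^-1) => *; lra.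
Qed.

Lemma lnS_le (R : realType) r : (0 < r)%N -> ln (r.+1%:R : R) <= ln r%:R + r%:R^-1.
Proof.
move=> r0; have a0 : 0 < r%:R :> R by rewrite ltr0n.
have b0 : 0 < r.+1%:R :> R by rewrite ltr0n.
have := lnB_le b0 a0; have -> : r.+1%:R / r%:R - 1 = r%:R^-1 :> R.
  by rewrite -natr1; field; rewrite gt_eqF.
by move: (ln r%:R) (ln r.+1%:R) (r%:R^-1) => *; lra.
Qed.

Lemma ln_factS (R : realType) r : ln (r.+1`!%:R : R) = ln r.+1%:R + ln r`!%:R.
Proof. by rewrite factS natrM lnM ?posrE ?ltr0n ?fact_gt0. Qed.

Lemma ln_fact_le (R : realType) r : (0 < r)%N ->
  ln (r`!%:R : R) <= r%:R * (ln r%:R - 1) + ln r%:R + 1.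
Proof.
elim: r => // -[|r] IH _; first by rewrite factS fact0 muln1 ln1; lra.
rewrite ln_factS; have := IH isT; have := @lnS_ge R r.+1 isT.
set a := ln r.+1%:R; set b := ln r.+2%:R; set f := ln _.
rewrite -[r.+2%:R]natr1; set q := r.+1%:R => H1 H2.
have q0 : 0 < q + 1 by rewrite /q natr1 ltr0n.
have := ler_wpM2l (ltW q0) H1; rewrite mulrDr divff ?gt_eqF //; nra.
Qed.

Lemma ln_fact_ge (R : realType) r : r%:R * (ln (r%:R : R) - 1) <= ln r`!%:R.
Proof.
elim: r => [|[|r] IH]; first by rewrite mul0r fact0 ln1.
  by rewrite factS fact0 muln1 ln1; lra.
rewrite ln_factS; have := IH; have := @lnS_le R r.+1 isT.
set a := ln r.+1%:R; set b := ln r.+2%:R; set f := ln _.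
rewrite -[r.+2%:R]natr1; set q := r.+1%:R => H1 H2.
have q0 : 0 < q by rewrite /q ltr0n.
have := ler_wpM2l (ltW q0) H1; rewrite mulrDr divff ?gt_eqF //; nra.
Qed.

Lemma harmonic_sum_le (R : realType) n :
  \sum_(i < n) (i.+1%:R^-1 : R) <= ln n%:R + 1.
Proof.
case: n => [|n]; first by rewrite big_ord0 ln0 ?lexx // add0r ler01.
elim: n => [|n IH]; first by rewrite big_ord_recr big_ord0 /= ln1 invr1 !add0r.
rewrite big_ord_recr /=; have := @lnS_ge R n.+1 isT; move: IH.
by move: (\sum_(i < _) _) (ln n.+1%:R) (ln n.+2%:R) (n.+2%:R^-1) => *; lra.
Qed.

Lemma sum_rev (V : nmodType) n (f : nat -> V) :
  \sum_(m < n) f (n - m)%N = \sum_(i < n) f i.+1.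
Proof.
rewrite (reindex_inj rev_ord_inj) /=; apply: eq_bigr => i _.
by rewrite subKn.
Qed.

(** Truncated subtraction sends the lowest indices to 0, where f vanishes. With f the inverse, this
    covers the degrees r <= |Z|. *)
Lemma sum_shift_le (R : numDomainType) n z (f : nat -> R) :
  f 0 = 0 -> (forall r, 0 <= f r) ->
  \sum_(i < n) f (i.+1 - z)%N <= \sum_(i < n) f i.+1.
Proof.
move=> f0 fge; elim: z => [|z IH]; first by under eq_bigr do rewrite subn0.
apply: le_trans IH; under eq_bigr do rewrite subSS.
case: n => [|n]; first by rewrite !big_ord0.
by rewrite big_ord_recl sub0n f0 add0r [leRHS]big_ord_recr /= lerDl.
Qed.

Lemma sum_ln_fact (R : realType) n : \sum_(i < n) ln (i.+1%:R : R) = ln n`!%:R.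
Proof.
elim: n => [|n IH]; first by rewrite big_ord0 fact0 ln1.
by rewrite big_ord_recr /= IH ln_factS addrC.
Qed.

(** * Bregman's bound applied row by row *)

Lemma ln_fact_root_le (R : realType) r N : (0 < r <= N)%N ->
  ln_fact_root R r <= ln r%:R - 1 + (ln N%:R + 1) / r%:R.
Proof.
case/andP=> r0 rN; have a0 : 0 < r%:R :> R by rewrite ltr0n.
rewrite /ln_fact_root ler_pdivrMr // mulrDl divfK ?gt_eqF //.
have : ln (r%:R : R) <= ln N%:R by rewrite ler_ln ?posrE ?ltr0n ?ler_nat // (leq_trans r0).
by have := @ln_fact_le R r r0; nra.
Qed.

(** The two reciprocals are the Stirling errors at degrees n - m and n - m - |Z|; keeping both makes
    one formula serve the columns inside and outside Y. The last term is the gain ln((r - |Z|)/r) <=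
    -|Z|/n, r = n - m, over the columns of Y. *)
Definition row_bound (R : realType) n (X Y Z : {set 'I_n}) (m : nat) : R :=
  n%:R * (ln (n - m)%:R - 1 +
          (ln n%:R + 1) * ((n - m)%:R^-1 + (n - m - #|Z|)%:R^-1)) -
  (if (m < #|X|)%N then #|Y|%:R * (#|Z|%:R / n%:R) else 0).

Lemma ln_nperm_extension_le (R : realType) n (X Y Z : {set 'I_n}) m w :
  (m < n)%N -> w \in rectangles (avoids_box X Y Z) m ->
  (0 < nperm (extension (avoids_box X Y Z) w))%N ->
  ln (nperm (extension (avoids_box X Y Z) w))%:R <= row_bound R X Y Z m.
Proof.
move=> mn wm N0; apply: le_trans (bregman R N0) _.
have n0 : 0 < n%:R :> R by rewrite ltr0n (leq_ltn_trans _ mn).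
have lnn0 : 0 <= ln (n%:R : R) + 1.
  by rewrite addr_ge0 // ln_ge0 // ler1n (leq_ltn_trans _ mn).
have [s] : exists s : 'S_n, s \in allowed_perms (extension (avoids_box X Y Z) w).
  by apply/set0Pn; rewrite -card_gt0.
rewrite inE => /forallP sB.
have deg_gt0 j : (0 < #|[pred v | extension (avoids_box X Y Z) w j v]|)%N.
  by apply/card_gt0P; exists (s j); rewrite inE.
apply: (@le_trans _ _ (\sum_(j < n) ((ln (n - m)%:R - 1 +
   (ln n%:R + 1) * ((n - m)%:R^-1 + (n - m - #|Z|)%:R^-1)) -
   (if (m < #|X|)%N && (j \in Y) then #|Z|%:R / n%:R else 0)))); last first.
  rewrite big_split /= sumr_const card_ord /row_bound.
  rewrite [n%:R * (_ + _)]mulr_natl lerD2l sumrN lerN2.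
  case: (m < #|X|)%N => /=; last by rewrite big1.
  by rewrite -big_mkcond /= sumr_const mulr_natl.
apply: ler_sum => j _; have := deg_gt0 j; rewrite (card_avoids_box_extension j wm).
case: ifP => _; rewrite ?subn0 ?subr0 => r0.
  apply: le_trans (@ln_fact_root_le R _ n _) _.
    by rewrite r0 /= -subnDA leq_subr.
  have nm0 : 0 < (n - m)%:R :> R by rewrite ltr0n subn_gt0.
  have rp : 0 < (n - m - #|Z|)%:R :> R by rewrite ltr0n.
  have Hz : (n - m - #|Z|)%:R / (n - m)%:R - 1 <= - (#|Z|%:R / n%:R) :> R.
    rewrite natrB; last by rewrite ltnW // -subn_gt0.
    rewrite mulrBl divff ?gt_eqF // addrAC subrr add0r lerN2.
    rewrite ler_wpM2l ?ler0n // lef_pV2 ?posrE // ler_nat leq_subr //.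
  have := lnB_le rp nm0; have : 0 <= (ln n%:R + 1) * (n - m)%:R^-1 :> R.
    by rewrite mulr_ge0 // invr_ge0 ltW.
  by rewrite mulrDr; lra.
apply: le_trans (@ln_fact_root_le R _ n _) _; first by rewrite r0 /= leq_subr.
by rewrite mulrDr lerD2l lerDl mulr_ge0 // invr_ge0 ler0n.
Qed.

Lemma size_avoids_box_le (R : realType) n (X Y Z : {set 'I_n}) m : (m <= n)%N ->
  (size (rectangles (avoids_box X Y Z) m))%:R <=
  expR (\sum_(i < m) row_bound R X Y Z i).
Proof.
elim: m => [|m IH] mn; first by rewrite big_ord0 expR0.
rewrite size_rectanglesS big_ord_recr expRD /= natr_sum.
apply: (@le_trans _ _ (\sum_(w <- rectangles (avoids_box X Y Z) m)
   expR (row_bound R X Y Z m))).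
  rewrite !big_seq; apply: ler_sum => w wm.
  (* A rectangle without extension contributes 0; otherwise all degrees are positive and Bregman's
     bound applies. *)
  have [->|N0] := posnP (nperm (extension (avoids_box X Y Z) w)); first exact: expR_ge0.
  rewrite -[X in X <= _]lnK ?posrE ?ltr0n // ler_expR.
  exact: ln_nperm_extension_le.
rewrite big_const_seq count_predT iter_addr_0 -mulr_natl.
by rewrite ler_wpM2r ?expR_ge0 // IH // ltnW.
Qed.

Lemma sum_row_bound_le (R : realType) n (X Y Z : {set 'I_n}) : (0 < n)%N ->
  \sum_(m < n) row_bound R X Y Z m <=
  n%:R * (ln n`!%:R - n%:R + (ln n%:R + 1) * (2 * (ln n%:R + 1))) -
  (box_volume X Y Z)%:R / n%:R.
Proof.
move=> n0; rewrite big_split /= sumrN; apply: lerB; last first.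
  rewrite -big_mkcond /=.
  have Xn : (#|X| <= n)%N by rewrite -[leqRHS](card_ord n) max_card.
  rewrite (@big_ord_narrow _ _ _ _ _ _ Xn) sumr_const card_ord.
  by rewrite /box_volume !natrM -[leRHS]mulr_natl !mulrA.
rewrite -mulr_sumr ler_wpM2l ?ler0n // big_split /= big_split /=.
rewrite (sum_rev n (fun r => ln r%:R : R)) sum_ln_fact sumr_const card_ord mulNrn.
rewrite lerD2l -mulr_sumr ler_wpM2l //.
  by rewrite addr_ge0 // ln_ge0 // ler1n.
rewrite big_split /= (sum_rev n (fun r => r%:R^-1 : R)).
rewrite (sum_rev n (fun r => (r - #|Z|)%:R^-1 : R)).
have H := harmonic_sum_le R n.
have : \sum_(i < n) (i.+1 - #|Z|)%:R^-1 <= ln n%:R + 1 :> R.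
  apply: le_trans H; apply: (@sum_shift_le R n _ (fun r => r%:R^-1)) => [|r].
    by rewrite invr0.
  by rewrite invr_ge0 ler0n.
by lra.
Qed.

Lemma latin_squares_gt0 n : (0 < #|latin_squares n|)%N.
Proof.
have := card_latin_squares_ge n; rewrite !lt0n; apply: contraTneq => ->.
by rewrite muln0 -ltnNge muln_gt0 !expn_gt0 fact_gt0.
Qed.

(** Replacing each of the n^2 terms ln(n + 1) by ln n + 1/n costs n in all, which is the final -1
    under the factor n. *)
Lemma card_latin_squares_geR (R : realType) n : (0 < n)%N ->
  expR (n%:R * (2 * ln n`!%:R - n%:R * ln n%:R - 1)) <= #|latin_squares n|%:R :> R.
Proof.
move=> n0; have L0 : 0 < #|latin_squares n|%:R :> R by rewrite ltr0n latin_squares_gt0.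
have := card_latin_squares_ge n; rewrite -(ler_nat R) !natrM !natrX.
have f0 : 0 < n`!%:R :> R by rewrite ltr0n fact_gt0.
have S0 : 0 < n.+1%:R :> R by rewrite ltr0n.
rewrite -[X in _ -> _ <= X]lnK ?posrE // ler_expR => H.
have {H} : ln (n`!%:R ^+ n * n`!%:R ^+ n) <=
    ln (n.+1%:R ^+ n ^+ n * #|latin_squares n|%:R) :> R.
  by rewrite ler_ln ?posrE ?mulr_gt0 ?exprn_gt0.
rewrite !lnM ?posrE ?exprn_gt0 // !lnXn ?exprn_gt0 // -[ln n`!%:R *+ n]mulr_natl.
rewrite -[ln n.+1%:R *+ n *+ n]mulr_natl -[ln n.+1%:R *+ n]mulr_natl => H.
have nR : 0 < n%:R :> R by rewrite ltr0n.
have := ler_wpM2l (mulr_ge0 (ltW nR) (ltW nR)) (lnS_le R n0).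
rewrite mulrDr mulfK ?gt_eqF //.
move: H; move: (ln (n`!%:R : R)) (ln (n.+1%:R : R)) (ln (n%:R : R)).
move: (ln (#|latin_squares n|%:R : R)) => d a b c.
by move: (n%:R : R) => q *; nra.
Qed.

(** The main terms cancel by ln n! >= n (ln n - 1). What remains is the e^n lost in the lower count,
    the two harmonic sums and the gain |X||Y||Z|/n. *)
Lemma empty_box_card_le (R : realType) n (X Y Z : {set 'I_n}) : (0 < n)%N ->
  #|[set L in latin_squares n | empty_box L X Y Z]%SET|%:R <=
  #|latin_squares n|%:R *
  expR (n%:R * (1 + 2 * (ln n%:R + 1) ^+ 2) - (box_volume X Y Z)%:R / n%:R) :> R.
Proof.
move=> n0.
apply: le_trans (_ : (size (rectangles (avoids_box X Y Z) n))%:R <= _).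
  by rewrite ler_nat card_empty_box_le.
apply: le_trans (size_avoids_box_le R X Y Z (leqnn n)) _.
apply: le_trans (ler_wpM2r (expR_ge0 _) (card_latin_squares_geR R n0)).
rewrite -expRD ler_expR; apply: le_trans (sum_row_bound_le R X Y Z n0) _.
have := ler_wpM2l (ler0n R n) (ln_fact_ge R n).
move: (ln n`!%:R) (ln n%:R) ((box_volume X Y Z)%:R / n%:R) => a l v.
by rewrite expr2; move: (n%:R : R) => q *; nra.
Qed.

(** * Union bound over boxes and the limit *)

Lemma max_empty_box_gt (R : realType) n (L : array n) (T : R) : 0 <= T ->
  ~~ ((max_empty_box L)%:R <= T) ->
  exists B : {set 'I_n} * {set 'I_n} * {set 'I_n},
    empty_box L B.1.1 B.1.2 B.2 && (T < (box_volume B.1.1 B.1.2 B.2)%:R).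
Proof.
move=> T0 H; apply/existsP; apply: contraT => /existsPn noB; case/negP: H.
rewrite /max_empty_box; elim/big_ind: _ => //.
  by move=> a b aT bT; rewrite /maxn; case: ifP.
move=> B emptyB; have := noB B; rewrite emptyB /=.
by rewrite -leNgt.
Qed.

Lemma large_empty_box_card_le (R : realType) n (T : R) : (0 < n)%N -> 0 <= T ->
  #|[set L in latin_squares n | ~~ ((max_empty_box L)%:R <= T)]%SET|%:R <=
  #|latin_squares n|%:R *
  expR (n%:R * (4 + 2 * (ln n%:R + 1) ^+ 2) - T / n%:R) :> R.
Proof.
move=> n0 T0.
pose V (B : {set 'I_n} * {set 'I_n} * {set 'I_n}) : R :=
  (box_volume B.1.1 B.1.2 B.2)%:R.
pose N (B : {set 'I_n} * {set 'I_n} * {set 'I_n}) : nat :=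
  #|[set L in latin_squares n | empty_box L B.1.1 B.1.2 B.2]%SET|.
apply: (@le_trans _ _ (\sum_(B | (T < V B)%R) N B)%N%:R).
  rewrite ler_nat; under eq_bigr do rewrite /N -sum1_card big_mkcond.
  rewrite exchange_big /= -sum1_card big_mkcond /=; apply: leq_sum => L _.
  rewrite inE; case: ifP => // /andP[LS /(max_empty_box_gt T0)[B /andP[eB TB]]].
  by rewrite (bigD1 B) //= inE LS eB.
rewrite natr_sum.
apply: (@le_trans _ _ (\sum_(B : {set 'I_n} * {set 'I_n} * {set 'I_n})
  #|latin_squares n|%:R * expR (n%:R * (1 + 2 * (ln n%:R + 1) ^+ 2) - T / n%:R))).
  rewrite big_mkcond /=; apply: ler_sum => B _; case: ifP => [TB|_]; last first.
    by rewrite mulr_ge0 ?expR_ge0.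
  apply: le_trans (empty_box_card_le R _ _ _ n0) _.
  rewrite ler_wpM2l ?ler0n // ler_expR lerD2l lerN2 ler_wpM2r ?invr_ge0 ?ler0n //.
  exact: ltW.
(* The extra 3 n pays for the (2^n)^3 triples of sets, by 2 <= e. *)
have -> : expR (n%:R * (4 + 2 * (ln n%:R + 1) ^+ 2) - T / n%:R) =
    expR (n%:R * (1 + 2 * (ln n%:R + 1) ^+ 2) - T / n%:R) * expR (3 * n%:R) :> R.
  by rewrite -expRD; congr expR; ring.
rewrite sumr_const -[leLHS]mulr_natr -mulrA ler_wpM2l ?ler0n //.
rewrite ler_wpM2l ?expR_ge0 //.
have card_boxes : #|{: {set 'I_n} * {set 'I_n} * {set 'I_n}}| = (2 ^ (3 * n))%N.
  have card1 : #|{: {set 'I_n}}| = (2 ^ n)%N.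
    by rewrite -cardsT -powersetT card_powerset cardsT card_ord.
  by rewrite !card_prod card1 -!expnD; congr (2 ^ _)%N; lia.
rewrite card_boxes natrX -natrM -[(3 * n)%:R]mulr1 expRM_natl.
by rewrite lerXn2r ?nnegrE ?expR_ge0 //; have := expR_ge1Dx (1 : R).
Qed.

Lemma ln_ge1 (R : realType) n : (4 <= n)%N -> 1 <= ln (n%:R : R).
Proof.
move=> n4; apply: (@le_trans _ _ (ln (2 ^+ 2 : R))); last first.
  by rewrite -natrX ler_ln ?posrE ?ltr0n ?ler_nat // (leq_trans _ n4).
have two_gt0 : 0 < 2 :> R by [].
have := lnB_le ltr01 two_gt0; rewrite ln1 lnXn // -[ln 2 *+ 2]mulr_natl.
by move: (ln 2) => l; lra.
Qed.

Local Open Scope classical_set_scope.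
Local Open Scope ring_scope.

Theorem theorem1p2 (R : realType) :
  exists C : R, 0 < C /\
    (fun n : nat =>
       uniform_draw_prob R (latin_squares n)
         (fun L : array n =>
            (max_empty_box L)%:R <= C * n%:R ^+ 2 * ln (n%:R : R) ^+ 2))
      @ \oo --> (1 : R).
Proof.
(* Once ln n >= 1, which holds for n >= 4, one has 4 + 2 (ln n + 1)^2 <= 12 (ln n)^2. The constant
   13 leaves a surplus of n (ln n)^2 >= n, so the failure probability is at most exp(-n) <= 1/(n +
   1). *)
exists 13; split => //.
apply: (squeeze_cvgr (f := fun n => 1 - harmonic n) (h := fun=> 1)); last 2 first.
- rewrite -[X in _ --> X]subr0; apply: cvgB; [exact: cvg_cst|exact: cvg_harmonic].
- exact: cvg_cst.
near=> n; have n4 : (4 <= n)%N by near: n; exists 4%N.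
have n0 : (0 < n)%N by apply: leq_trans n4.
have nR : 0 < n%:R :> R by rewrite ltr0n.
rewrite /uniform_draw_prob; set T := 13 * _ * _.
have LS0 : 0 < #|latin_squares n|%:R :> R by rewrite ltr0n latin_squares_gt0.
have T0 : 0 <= T by apply: mulr_ge0; rewrite ?sqr_ge0 // mulr_ge0 ?sqr_ge0 ?ler0n.
have bad := large_empty_box_card_le n0 T0.
have split_LS : #|latin_squares n|%:R =
    #|[set L in latin_squares n | (max_empty_box L)%:R <= T]%SET|%:R +
    #|[set L in latin_squares n | ~~ ((max_empty_box L)%:R <= T)]%SET|%:R :> R.
  rewrite -natrD -(cardsID [set L : array n | (max_empty_box L)%:R <= T]%SET (latin_squares n)).
  by congr (_ + _)%:R; apply: eq_card => L; rewrite !inE // andbC.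
apply/andP; split; last first.
  by rewrite ler_pdivrMr // mul1r split_LS lerDl ler0n.
rewrite ler_pdivlMr // mulrBl mul1r lerBlDl {1}split_LS addrC lerD2r.
apply: le_trans bad _; rewrite mulrC ler_wpM2r ?ler0n //.
have l1 := ln_ge1 R n4.
apply: (@le_trans _ _ (expR (- n%:R))).
  rewrite ler_expR; have -> : T / n%:R = 13 * n%:R * ln n%:R ^+ 2.
    by rewrite /T; field; rewrite gt_eqF.
  move: l1; move: (ln (n%:R : R)) => l l1.
  have l2 : 0 <= n%:R * (l ^+ 2 - 1) by rewrite mulr_ge0 ?ler0n //; nra.
  have l3 : 0 <= n%:R * (l ^+ 2 - l) by rewrite mulr_ge0 ?ler0n //; nra.
  by move: l2 l3; move: (n%:R : R) nR => q; nra.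
rewrite /harmonic expRN lef_pV2 ?posrE ?expR_gt0 ?ltr0n //.
by rewrite -natr1 addrC expR_ge1Dx.
Unshelve. all: by end_near. Qed.
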